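(* Let $n$ be a positive integer and let $L_n$ be an $n$-element chain. Then $$|\mathrm{DW}_1(L_n)|=\begin{cases} nC(n), & n\in\{1,2\};\\ nC(n)+\displaystyle\sum_{k=1}^{n-2}\sum_{p=k}^{n-2}\binom{p}{k}C(n-k), & n\ge 3.\end{cases}$$
   Context: $C(n)=\frac{1}{n+1}\binom{2n}{n}$ is the $n$-th Catalan number. A chain is a totally ordered set, regarded as a lattice. A difference operator on a lattice $L$ is a map $d:L\to L$ with $d(x\wedge y)=(d(x)\wedge y)\vee(x\wedge d(y))\vee(d(x)\wedge d(y))$ for all $x,y\in L$; the set of these is $\mathrm{DW}_1(L)$. *)

(* Defs.v *)
From mathcomp Require Import all_boot all_order.

Set Implicit Arguments.
Unset Strict Implicit.
Unset Printing Implicit Defensive.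

Local Open Scope order_scope.

Definition difference_operator (disp : Order.disp_t) (L : latticeType disp)
    (d : L -> L) : Prop :=
  forall x y : L,
    d (x `&` y) = (d x `&` y) `|` (x `&` d y) `|` (d x `&` d y).

Definition DW1 (disp : Order.disp_t) (L : finLatticeType disp) :
    {set {ffun L -> L}} :=
  [set d : {ffun L -> L} |
    [forall x, forall y,
      d (x `&` y) == (d x `&` y) `|` (x `&` d y) `|` (d x `&` d y)]].

Lemma DW1P (disp : Order.disp_t) (L : finLatticeType disp)
    (d : {ffun L -> L}) :
  reflect (difference_operator d) (d \in DW1 L).
Proof.
rewrite inE; apply: (iffP forallP) => [H x y|H x].
  exact/eqP/(forallP (H x)).
by apply/forallP => y; apply/eqP/H.
Qed.

Close Scope order_scope.

(* The division is exact: see [catalanE]. *)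
Definition catalan (n : nat) : nat := 'C(2 * n, n) %/ n.+1.

Lemma catalanE (n : nat) : n.+1 * catalan n = 'C(2 * n, n).
Proof.
rewrite /catalan mulnC divnK // -(@Gauss_dvdr n.+1 n) ?coprimeSn //.
have := mul_bin_left (2 * n) n.
by rewrite mul2n -addnn addnK => <-; apply: dvdn_mulr.
Qed.

(* Main.v *)
Require Import Defs.
From mathcomp Require Import all_boot all_order.
From mathcomp Require Import zify.

(** Read through ranks, an operator on an n-element chain is a function f on
    {0, ..., n-1}, and meets and joins are minima and maxima.  For i < j the
    difference equation then says that
      (f i <= j or f i <= f j)  and  (i <= f i or f j <= f i),
    so i <= f i as soon as j <= f j: the points where f is extensive form an
    initial segment {0, ..., k-1}, and k > 0 since 0 <= f 0.  The conditions
    decouple at this breakpoint k ([diff_seqs_weight_one],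
    [weight_one_diff_seqs]):
    - below k, f is monotone and extensive; if k < n, then comparison with the
      point k, where f k < k, bounds f by k;
    - from k on, f is antitone with values below k, because f k < k bounds all
      later values;
    - between a point below k and a point from k on, these bounds already
      imply the condition.

    The first half is a lattice path confined by the diagonal: it is counted by
    a ballot number, here always a Catalan number.  The second half is an
    arbitrary antitone sequence, counted by a binomial coefficient.  Hence
    there are
      C(n) + sum_(1 <= k < n) binom(n-1, k-1) C(k+1)
    operators ([size_diff_seqs]).  The term k = n-1 contributes (n-1) C(n), and
    reversing the order of the other terms gives the stated double sum, whose
    inner sum is binom(n-1, k+1) by the hockey-stick identity.

    Operators are counted through explicit duplicate-free lists of their
    sequences of values, so that splitting at the breakpoint is concatenation
    and each count is a recursion on lists. *)

(** * The two kinds of halves: monotone extensive and antitone sequences *)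

(** The sequences are built from the last entry v backwards: the remaining
    entries are then bounded by v alone, so monotonicity becomes a change of the
    bound, and the position of the last entry is known from the length. *)
Fixpoint monotone_extensive b k : seq (seq nat) :=
  if k is k'.+1 then
    [seq rcons u v | v <- iota k' (b.+1 - k'), u <- monotone_extensive v k']
  else [:: [::]].

Fixpoint antitone c m : seq (seq nat) :=
  if m is m'.+1 then [seq v :: w | v <- iota 0 c.+1, w <- antitone v m']
  else [:: [::]].

Lemma monotone_extensiveS b k :
  monotone_extensive b k.+1 =
    [seq rcons u v | v <- iota k (b.+1 - k), u <- monotone_extensive v k].
Proof. by []. Qed.

Lemma mem_monotone_extensive b k u :
  reflect [/\ size u = k,
              forall i, i < k -> i <= nth 0 u i <= b
            & forall i j, i < j < k -> nth 0 u i <= nth 0 u j]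
          (u \in monotone_extensive b k).
Proof.
elim: k b u => [|k IHk] b u /=.
  by rewrite inE; apply: (iffP eqP) => [->|[/size0nil]//]; split=> // i j; lia.
apply: (iffP allpairsPdep) => [[v [u' [v_range /IHk[su' ext mono] ->]]]|].
  move: v_range; rewrite mem_iota => v_range; split.
  - by rewrite size_rcons su'.
  - move=> i i_lt; rewrite nth_rcons su'.
    by have := ext i; case: ifP => ? ; [|case: eqP]; lia.
  - move=> i j ij; rewrite !nth_rcons su'.
    have := ext i; have := mono i j.
    by case: (ltnP i k) => ?; case: (ltnP j k) => ?; case: (j =P k) => ?; lia.
case/lastP: u => [|u v] [//]; rewrite size_rcons => -[su] ext mono.
have nthu i : i < k -> nth 0 (rcons u v) i = nth 0 u i.
  by move=> ik; rewrite nth_rcons su ik.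
have nthv : nth 0 (rcons u v) k = v by rewrite nth_rcons su ltnn eqxx.
exists v, u; split=> //.
  by have := ext k (leqnn _); rewrite nthv mem_iota; lia.
apply/IHk; split=> // [i ik|i j /andP[ij jk]].
  by have := ext i (leqW ik); have := mono i k; rewrite nthv nthu //; lia.
by rewrite -!nthu ?mono ?ij //; lia.
Qed.

Lemma antitoneS c m :
  antitone c m.+1 = [seq v :: w | v <- iota 0 c.+1, w <- antitone v m].
Proof. by []. Qed.

Lemma mem_antitone c m w :
  reflect [/\ size w = m,
              forall i, i < m -> nth 0 w i <= c
            & forall i j, i < j < m -> nth 0 w j <= nth 0 w i]
          (w \in antitone c m).
Proof.
elim: m c w => [|m IHm] c w; rewrite ?antitoneS.
  by rewrite /= inE; apply: (iffP eqP) => [->|[/size0nil]//]; split=> // i j; lia.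
apply: (iffP allpairsPdep) => [[v [w' [v_range /IHm[sw' bnd anti] ->]]]|].
  move: v_range; rewrite mem_iota => v_range; split=> [|[|i]|[|i] [|j]] //=.
  - by rewrite sw'.
  - by move=> /bnd; lia.
  - exact: bnd.
  - exact: anti.
case: w => [|v w] [//] [sw] bnd anti; exists v, w; split=> //.
  by rewrite mem_iota; have := bnd 0 isT; rewrite /=; lia.
apply/IHm; split=> // [i im|i j ij]; first exact: (anti 0 i.+1).
exact: (anti i.+1 j.+1).
Qed.

Lemma uniq_monotone_extensive b k : uniq (monotone_extensive b k).
Proof.
elim: k b => //= k IHk b; apply: allpairs_uniq_dep => //; first exact: iota_uniq.
by move=> [v u] [v' u'] _ _ /= /rcons_inj[-> ->].
Qed.

Lemma uniq_antitone c m : uniq (antitone c m).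
Proof.
elim: m c => // m IHm c; apply: allpairs_uniq_dep => //; first exact: iota_uniq.
by move=> [v w] [v' w'] _ _ /= [-> ->].
Qed.

(** * Counting the halves *)

Lemma sum_bin_upper k n : \sum_(k <= p < n) 'C(p, k) = 'C(n, k.+1).
Proof.
elim: n => [|n IHn]; first by rewrite big_geq // bin0n.
have [kn|nk] := leqP k n; first by rewrite big_nat_recr //= IHn binS.
by rewrite big_geq // bin_small.
Qed.

Lemma size_antitone c m : size (antitone c m) = 'C(c + m, m).
Proof.
elim: m c => [|m IHm] c; first by rewrite bin0.
rewrite antitoneS size_allpairs_dep sumnE big_map -/(index_iota 0 c.+1).
under eq_bigr do rewrite IHm.
elim: c => [|c IHc]; first by rewrite big_nat1 !add0n !binn.
by rewrite big_nat_recr //= IHc (addSnnS c m) [in RHS]addSn binS.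
Qed.

(** The ballot numbers, in the shape given by the reflection principle: among the
    'C(b + k, b) unconstrained monotone sequences of length k with values at most
    b, the non-extensive ones reflect to paths counted by 'C(b + k, b.+2).  The
    bound on k reaches the empty case k = b.+2, where both sides agree, and this
    is where the induction on b starts. *)
Lemma size_monotone_extensive b k : k <= b.+2 ->
  size (monotone_extensive b k) + 'C(b + k, b.+2) = 'C(b + k, b).
Proof.
elim: k b => [|k IHk] b kb; first by rewrite addn0 bin_small // binn.
rewrite monotone_extensiveS size_allpairs_dep sumnE big_map.
rewrite -/(index_iota k b.+1).
(* The sum over the last entry grows by one term with b: Pascal's rule. *)
have [t bE] : {t | b.+1 = k + t} by exists (b.+1 - k); lia.
elim: t b bE {kb} => [|t IHt] b bE.
  rewrite big_geq ?add0n; last lia.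
  have -> : b.+2 = (b + k.+1) - b by lia.
  by rewrite bin_sub //; lia.
rewrite big_nat_recr /=; last lia.
case: b bE => [|b] bE.
  have [-> _] : k = 0 /\ t = 0 by lia.
  by rewrite big_geq.
have bkt : b.+1 = k + t by lia.
have := IHt b bkt; have := IHk b.+1 _ => /(_ ltac:(lia)).
rewrite !addSn !addnS !(binS _.+1) !binS; lia.
Qed.

(** * Operators as concatenations of two halves *)

(** The candidate value sequences, indexed by the breakpoint k.  A breakpoint
    k < n bounds the first half by k; for k = n the only bound is n.-1. *)
Definition diff_seqs n :=
  [seq w | k <- iota 1 n,
           w <- [seq u ++ v | u <- monotone_extensive (minn k n.-1) k,
                              v <- antitone k.-1 (n - k)]].

(** The difference equation on the chain of ranks below n, where meets and joins
    are minima and maxima. *)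
Definition weight_one (f : nat -> nat) n :=
  forall i j, i < n -> j < n ->
    f (minn i j) = maxn (maxn (minn (f i) j) (minn i (f j))) (minn (f i) (f j)).

(** The equation is symmetric, and trivial for i = j.  For i < j its left-hand
    side is f i, and two of the three terms on the right are minima with f i.
    So only minn i (f j) can exceed f i, and f i is attained unless it is greater
    than both j and f j. *)
Lemma weight_one_ltP f n :
  weight_one f n <->
  (forall i j, i < j < n ->
     ((f i <= j) || (f i <= f j)) && ((i <= f i) || (f j <= f i))).
Proof.
split=> [w1 i j /andP[ij jn]|w1].
  have := w1 i j (ltn_trans ij jn) jn; rewrite (minn_idPl (ltnW ij)); lia.
have {}w1 i j : i < j < n ->
    f (minn i j) = maxn (maxn (minn (f i) j) (minn i (f j))) (minn (f i) (f j)).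
  move=> ijn; have /andP[ij _] := ijn.
  by have := w1 i j ijn; rewrite (minn_idPl (ltnW ij)); lia.
move=> i j i_n j_n; have [->|] := eqVneq i j.
  by rewrite minnn [minn (f j) j]minnC maxnn minnn; apply/esym/maxn_idPr/geq_minr.
rewrite neq_ltn => /orP[ij|ji]; first by apply: w1; rewrite ij.
rewrite minnC w1 ?ji // [minn (f j) i]minnC [minn j (f i)]minnC.
by rewrite [minn (f i) (f j)]minnC [maxn (minn i _) _]maxnC.
Qed.

Lemma diff_seqs_weight_one n w : w \in diff_seqs n ->
  [/\ size w = n, forall i, i < n -> nth 0 w i < n & weight_one (nth 0 w) n].
Proof.
case/allpairsPdep=> k [w' [k_range]].
case/allpairsPdep=> u [v [/mem_monotone_extensive[su uext umono]]].
case/mem_antitone=> sv vbnd vanti -> ->.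
move: k_range; rewrite mem_iota => k_range.
have nthw i : nth 0 (u ++ v) i = if i < k then nth 0 u i else nth 0 v (i - k).
  by rewrite nth_cat su.
split=> [|i i_lt|].
- by rewrite size_cat su sv; lia.
- rewrite nthw; case: ifP => ik; first by have := uext i ik; lia.
  by have := vbnd (i - k); lia.
apply/weight_one_ltP => i j /andP[ij jn]; rewrite !nthw.
case: (ltnP i k) => ik; case: (ltnP j k) => jk.
- by have := uext i ik; have := umono i j; lia.
- by have := uext i ik; lia.
- lia.
- by have := vbnd (i - k); have := vanti (i - k) (j - k); lia.
Qed.

(** The breakpoint k is the least point with f k < k, or n if there is none; it is
    positive because 0 <= f 0. *)
Lemma first_descent (f : nat -> nat) n : 0 < n ->
  exists2 k, 0 < k <= n & (forall i, i < k -> i <= f i) /\ (k < n -> f k < k).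
Proof.
move=> n_gt0; have [/existsP ex|/existsPn nex] := boolP [exists i : 'I_n, f i < i].
  have {}ex : exists i, (i < n) && (f i < i).
    by case: ex => i fi; exists i; rewrite ltn_ord.
  case: (ex_minnP ex) => k /andP[kn fk] kmin; exists k; first lia.
  by split=> // i ik; rewrite leqNgt; apply/negP => fi; have := kmin i; lia.
exists n; first lia.
by split=> [i i_n|]; [have := nex (Ordinal i_n); rewrite -leqNgt | lia].
Qed.

(** The breakpoint k bounds both halves: f k < k keeps the earlier values at most
    k and the later ones below k, so every later point is a descent too. *)
Lemma weight_one_diff_seqs n w : 0 < n -> size w = n ->
  (forall i, i < n -> nth 0 w i < n) -> weight_one (nth 0 w) n -> w \in diff_seqs n.
Proof.
move=> n_gt0 sw wbnd /weight_one_ltP w1.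
have [k k_range [before at_k]] := first_descent (nth 0 w) n n_gt0.
have after i : k <= i < n -> nth 0 w i < i.
  move=> /andP[ki i_n]; have := at_k (leq_ltn_trans ki i_n) => wk.
  have [<-//|ki'] := eqVneq k i.
  by have := w1 k i; lia.
apply/allpairsPdep; exists k, w; split=> //; first by rewrite mem_iota; lia.
apply/allpairsPdep; exists (take k w), (drop k w).
rewrite cat_take_drop; split=> //.
  apply/mem_monotone_extensive; split.
  - by rewrite size_take_min sw; lia.
  - move=> i ik; rewrite nth_take //.
    by have := before i ik; have := wbnd i; have := w1 i k; have := after k; lia.
  - move=> i j /andP[ij jk]; rewrite !nth_take //; last exact: ltn_trans jk.
    by have := before i; have := before j; have := w1 i j; lia.
apply/mem_antitone; split.
- by rewrite size_drop sw.
- move=> i i_lt; rewrite nth_drop.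
  have [->|i_gt0] := posnP i; first by rewrite addn0; have := after k; lia.
  by have := after k; have := w1 k (k + i); lia.
- move=> i j ij; rewrite !nth_drop.
  by have := after (k + i); have := w1 (k + i) (k + j); lia.
Qed.

(** The breakpoint can be read off the concatenation as its first descent, and
    its two halves are then recovered by length. *)
Lemma uniq_diff_seqs n : uniq (diff_seqs n).
Proof.
apply: allpairs_uniq_dep => [|k _|]; first exact: iota_uniq.
  apply: allpairs_uniq_dep => [|u _|];
    rewrite ?uniq_monotone_extensive ?uniq_antitone //.
  move=> p q /allpairsPdep[u [v [/mem_monotone_extensive[su _ _] _ ->]]].
  move=> /allpairsPdep[u' [v' [/mem_monotone_extensive[su' _ _] _ ->]]] /= /eqP.
  by rewrite eqseq_cat ?su ?su' // => /andP[/eqP-> /eqP->].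
have breakpoint k w : k \in iota 1 n ->
    w \in [seq u ++ v | u <- monotone_extensive (minn k n.-1) k,
                        v <- antitone k.-1 (n - k)] ->
    [/\ 0 < k <= n, forall i, i < k -> i <= nth 0 w i
      & k < n -> nth 0 w k < k].
  rewrite mem_iota => k_range.
  case/allpairsPdep=> u [v [/mem_monotone_extensive[su ext _]]].
  case/mem_antitone=> _ bnd _ ->.
  split=> [|i ik|kn]; first lia.
    by rewrite nth_cat su ik; case/andP: (ext i ik).
  by rewrite nth_cat su ltnn subnn; have := bnd 0; lia.
move=> p q /allpairsPdep[k [w [/breakpoint + /[dup] wk + ->]]].
move=> /[apply] -[k_range extk ltk].
move=> /allpairsPdep[k' [w' [/breakpoint + /[dup] wk' + ->]]].
move=> /[apply] -[k'_range extk' ltk'] /= ww'.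
rewrite -{w'}ww' in extk' ltk' wk' *.
suff -> : k = k' by [].
by have := extk k'; have := extk' k; lia.
Qed.

(** * The number of operators *)

(** The Catalan number as a difference of binomial coefficients, to match the
    reflection form of the ballot numbers. *)
Lemma catalan_reflection n : catalan n + 'C(2 * n, n.+1) = 'C(2 * n, n).
Proof.
apply/eqP; rewrite -(eqn_pmul2l (ltn0Sn n)) mulnDr catalanE mul_bin_left.
have -> : 2 * n - n = n by lia.
by rewrite -mulSn.
Qed.

Lemma size_monotone_extensive_full k :
  size (monotone_extensive k k.+1) = catalan k.+1.
Proof.
have := @size_monotone_extensive k k.+1 (leqnSn _).
have := catalan_reflection k.+1; have -> : 2 * k.+1 = (k + k.+1).+1 by lia.
rewrite !binS; lia.
Qed.

(** Extensivity forces the value k at position k, so that appending it identifies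
    the sequences of length k with those of length k.+1. *)
Lemma size_monotone_extensive_diag k :
  size (monotone_extensive k k) = catalan k.+1.
Proof.
rewrite -size_monotone_extensive_full monotone_extensiveS subSnn.
by rewrite size_allpairs_dep /= addn0.
Qed.

(** The summand outside the sum is the breakpoint k = n.+1, where the second half
    is empty. *)
Lemma size_diff_seqs n :
  size (diff_seqs n.+1) =
    catalan n.+1 + \sum_(1 <= k < n.+1) 'C(n, k.-1) * catalan k.+1.
Proof.
rewrite size_allpairs_dep sumnE big_map -/(index_iota 1 n.+2).
under eq_bigr => k _ do rewrite size_allpairs size_antitone.
rewrite big_nat_recr //= addnC; congr (_ + _).
  by rewrite subnn bin0 muln1 (minn_idPr (leqnSn n)) size_monotone_extensive_full.
apply: eq_big_nat => k k_range.
have -> : minn k n = k by lia.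
rewrite size_monotone_extensive_diag mulnC -bin_sub; last by lia.
by congr ('C(_, _) * _); lia.
Qed.

(** Ranks turn the chain into an initial segment of [nat], and an operator is
    determined by the sequence of the ranks of its values. *)
Lemma card_DW1 (disp : Order.disp_t) (L : finOrderType disp) :
  0 < #|L| -> #|DW1 L| = size (diff_seqs #|L|).
Proof.
move=> L_gt0; set n := #|L|.
pose rk (x : L) : nat := Order.enum_rank x.
have rk_lt x : rk x < n := ltn_ord _.
have rk_inj : injective rk by move=> x y /ord_inj/Order.EnumVal.enum_rank_inj.
pose vl i : L := Order.enum_val (insubd (Ordinal L_gt0) i).
have vlK i : i < n -> rk (vl i) = i.
  by move=> i_n; rewrite /rk /vl Order.EnumVal.enum_valK val_insubd i_n.
have rkK x : vl (rk x) = x by apply/rk_inj/vlK.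
have rk_le x y : (rk x <= rk y) = (x <= y)%O.
  exact: (Order.EnumVal.le_enum_rank Order.TotalTheory.le_total).
have rk_meet x y : rk (x `&` y)%O = minn (rk x) (rk y).
  case: (Order.TotalTheory.leP x y) => [xy|/Order.POrderTheory.ltW yx];
    apply/esym; [apply/minn_idPl|apply/minn_idPr]; by rewrite rk_le.
have rk_join x y : rk (x `|` y)%O = maxn (rk x) (rk y).
  case: (Order.TotalTheory.leP x y) => [xy|/Order.POrderTheory.ltW yx];
    apply/esym; [apply/maxn_idPr|apply/maxn_idPl]; by rewrite rk_le.
pose code (d : {ffun L -> L}) := mkseq (fun i => rk (d (vl i))) n.
have nth_code d i : i < n -> nth 0 (code d) i = rk (d (vl i)) by apply: nth_mkseq.
have code_inj : injective code.
  move=> d e de; apply/ffunP => x; apply: rk_inj.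
  by rewrite -(rkK x) -!nth_code // de.
have codeP d : reflect (weight_one (nth 0 (code d)) n) (d \in DW1 L).
  apply: (iffP (DW1P d)) => [dd i j i_n j_n|w1 x y].
    rewrite !nth_code ?gtn_min ?i_n // -{1}(vlK i) // -{1}(vlK j) // -rk_meet rkK dd.
    by rewrite !rk_join !rk_meet !vlK.
  apply: rk_inj; rewrite !rk_join !rk_meet.
  have := w1 (rk x) (rk y) (rk_lt x) (rk_lt y).
  by rewrite !nth_code ?gtn_min ?rk_lt // -rk_meet !rkK.
rewrite cardE -(size_map code); apply/perm_size/uniq_perm.
- by rewrite map_inj_uniq ?enum_uniq.
- exact: uniq_diff_seqs.
move=> w; apply/mapP/idP => [[d + ->]|w_diff].
  rewrite mem_enum => /codeP w1; apply: weight_one_diff_seqs; rewrite ?size_mkseq //.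
  by move=> i i_n; rewrite nth_code.
have [sw w_lt w1] := diff_seqs_weight_one _ _ w_diff.
pose d := [ffun x => vl (nth 0 w (rk x))].
have dE : w = code d.
  apply: (@eq_from_nth _ 0) => [|i]; rewrite sw ?size_mkseq // => i_n.
  by rewrite nth_code // ffunE !vlK ?w_lt.
by exists d => //; rewrite mem_enum; apply/codeP; rewrite -dE.
Qed.

Theorem theorem3p7 (n : nat) (n_gt0 : 0 < n)
    (disp : Order.disp_t) (L : finOrderType disp) (cardL : #|L| = n) :
  #|DW1 L| =
    if n \in [:: 1; 2] then n * catalan n
    else n * catalan n +
         \sum_(1 <= k < n.-1) \sum_(k <= p < n.-1) 'C(p, k) * catalan (n - k).
Proof.
rewrite card_DW1 ?cardL //.
suff -> : size (diff_seqs n) = n * catalan n +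
    \sum_(1 <= k < n.-1) \sum_(k <= p < n.-1) 'C(p, k) * catalan (n - k).
  by case: n n_gt0 {cardL} => [|[|[|n]]] //= _; rewrite big_geq ?addn0.
case: n n_gt0 {cardL} => // -[_|n _]; rewrite size_diff_seqs.
  by rewrite !big_geq.
(* The last term carries (n.+1) catalan n.+2 and completes the main term. *)
rewrite big_nat_recr //= binSn addnCA -mulSn addnC; congr (_ + _).
rewrite big_nat_rev /=; apply: eq_big_nat => k k_range.
rewrite -big_distrl /= sum_bin_upper -bin_sub; last by lia.
by congr ('C(_, _) * catalan _); lia.
Qed.
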